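(* Let $\mathcal{P}$ be a non-negative transition probability tensor of order $m$ and dimension $n$ with $\delta_m>\frac{m-2}{m-1}$, let $\eta_m=(1-\delta_m)(m-1)$, and let $\bar{x}$ be a solution of $x=\mathcal{P}x^{m-1}$, $x\ge 0$, $\|x\|_1=1$. Let $\eta>0$ satisfy $\eta<\frac{1-\eta_m}{1+\eta_m}$. Then, for any initial transition probability vector $x_0$, the iterative sequence $\{x_k\}$ generated by algorithm HOPMM-II with parameter $\eta$ converges to $\bar{x}$. Furthermore, the following error bound holds for all $k$: $$\|x_k-\bar{x}\|_1\le \epsilon_\eta^{\,k}\,\|x_0-\bar{x}\|_1,\qquad \text{where } \epsilon_\eta=(\eta+1)\eta_m+\eta.$$
   Context: Let $m\ge 2$, $n\ge 1$ and $\langle n\rangle=\{1,\dots,n\}$. An $m$th-order $n$-dimensional real tensor $\mathcal{P}=(p_{i_1i_2\cdots i_m})$, with $i_1,\dots,i_m\in\langle n\rangle$, is a (non-negative) transition probability tensor if $p_{i_1\cdots i_m}\ge 0$ for all indices and $\sum_{i_1=1}^n p_{i_1i_2\cdots i_m}=1$ for all $i_2,\dots,i_m$. A transition probability vector is a vector $x\in\mathbb{R}^n$ with $x\ge 0$ (entrywise) and $\sum_i x_i=1$. For $x\in\mathbb{R}^n$, the vector $\mathcal{P}x^{m-1}\in\mathbb{R}^n$ is defined by $$(\mathcal{P}x^{m-1})_i=\sum_{i_2,\ldots,i_m=1}^n p_{i i_2\cdots i_m}x_{i_2}\cdots x_{i_m},\quad i=1,\dots,n.$$ Define $$\delta_m=\min_{S\subset\langle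 n\rangle}\Big\{\min_{i_2,\ldots,i_m\in\langle n\rangle}\sum_{i\in S'}p_{i i_2\cdots i_m}+\min_{i_2,\ldots,i_m\in\langle n\rangle}\sum_{i\in S}p_{i i_2\cdots i_m}\Big\},$$ where $S$ ranges over subsets of $\langle n\rangle$ and $S'=\langle n\rangle\setminus S$. For $x\in\mathbb{R}^n$ let $x_+=\max(x,0)$ (entrywise) and $\mathrm{proj}(x)=x_+/\|x_+\|_1$ (when $x_+\neq 0$). Algorithm HOPMM-II (higher-order power method with heavy-ball momentum, parameter $\eta>0$), regarded as generating an infinite sequence (no stopping test): given $x_0$, for $k=1,2,3,\dots$ first set $x_k=\mathcal{P}x_{k-1}^{m-1}$. Periodically, namely at every 2nd step ($k=2,4,6,\dots$), then compute $\hat{x}_k=x_k+\eta(x_k-x_{k-1})$ and replace $x_k$ by $\mathrm{proj}(\hat{x}_k)$. *)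

(* Defs.v *)
From HB Require Import structures.
From mathcomp Require Import all_boot all_order all_algebra.
From mathcomp Require Import all_classical all_reals all_analysis.

Set Implicit Arguments.
Unset Strict Implicit.
Unset Printing Implicit Defensive.

Import Order.TTheory GRing.Theory Num.Theory.
Import numFieldNormedType.Exports.

Local Open Scope ring_scope.

(* The default 0 is only reached when I is empty. *)
Definition fin_min (R : realType) (I : finType) (F : I -> R) : R :=
  if [pick i : I] is Some i0 then F [arg min_(i < i0) F i]%O else 0.

Lemma fin_minP (R : realType) (I : finType) (F : I -> R) (i0 : I) :
  (exists i, fin_min F = F i) /\ (forall i, fin_min F <= F i).
Proof.
rewrite /fin_min; case: pickP => [i1 _|/(_ i0)//].
by case: arg_minP => // i _ Fi; split=> [|j]; [exists i|exact: Fi].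
Qed.

(* The indices i_2, ..., i_m, grouped and numbered from 0. *)
Definition tail_index (m n : nat) := {ffun 'I_m.-1 -> 'I_n}.

(* P i t is the entry p_{i t_0 ... t_(m-2)}: the first index is separated from
   the m - 1 others, so m is the order of the tensor as soon as 1 <= m. *)
Definition tensor (R : realType) (m n : nat) := 'I_n -> tail_index m n -> R.

Definition transition_tensor (R : realType) (m n : nat) (P : tensor R m n) :=
  (forall i t, 0 <= P i t) /\ (forall t, \sum_(i < n) P i t = 1).

Definition transition_vector (R : realType) (n : nat) (x : 'cV[R]_n) :=
  (forall i, 0 <= x i 0) /\ \sum_(i < n) x i 0 = 1.

Definition norm1 (R : realType) (n : nat) (x : 'cV[R]_n) : R :=
  \sum_(i < n) `|x i 0|.

Definition tensor_apply (R : realType) (m n : nat) (P : tensor R m n)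
    (x : 'cV[R]_n) : 'cV[R]_n :=
  \col_(i < n) \sum_(t : tail_index m n) P i t * \prod_(j < m.-1) x (t j) 0.

(* S ranges over all subsets, including the empty and the full one. *)
Definition delta (R : realType) (m n : nat) (P : tensor R m n) : R :=
  fin_min (fun S : {set 'I_n} =>
    fin_min (fun t : tail_index m n => \sum_(i in ~: S) P i t) +
    fin_min (fun t : tail_index m n => \sum_(i in S) P i t)).

Definition eta_coef (R : realType) (m n : nat) (P : tensor R m n) : R :=
  (1 - delta P) * (m%:R - 1).

Definition pos_part (R : realType) (n : nat) (x : 'cV[R]_n) : 'cV[R]_n :=
  \col_(i < n) Num.max (x i 0) 0.

(* Only meaningful when pos_part x != 0; otherwise the value is 0. *)
Definition proj (R : realType) (n : nat) (x : 'cV[R]_n) : 'cV[R]_n :=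
  (norm1 (pos_part x))^-1 *: pos_part x.

(* Power iteration; the steps of even index are followed by a momentum
   correction, in which x is the previous iterate and y the uncorrected one. *)
Fixpoint hopmm2 (R : realType) (m n : nat) (P : tensor R m n) (eta : R)
    (x0 : 'cV[R]_n) (k : nat) : 'cV[R]_n :=
  if k is k'.+1 then
    let x := hopmm2 P eta x0 k' in
    let y := tensor_apply P x in
    if odd k'.+1 then y else proj (y + eta *: (y - x))
  else x0.

(* Main.v *)
Require Import Defs.
From HB Require Import structures.
From mathcomp Require Import all_boot all_order all_algebra.
From mathcomp Require Import all_classical all_reals all_analysis.
From mathcomp Require Import ring lra.

Set Implicit Arguments.
Unset Strict Implicit.
Unset Printing Implicit Defensive.

Import Order.TTheory GRing.Theory Num.Theory.
Import numFieldNormedType.Exports.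

Local Open Scope classical_set_scope.
Local Open Scope ring_scope.

(** One step of the algorithm shrinks the l1 distance to the fixed point xbar
    by the factor epsilon = (eta + 1) * eta_m + eta, which the bound on eta
    makes smaller than 1; both conclusions follow by iterating this.

    The tensor map x |-> P x^(m-1) is eta_m-Lipschitz on probability vectors
    ([norm1_tensor_apply_le]).  Seen through the product laws p of x and q of y
    on the index tuples (i_2, ..., i_m), it is a Markov kernel applied to p and
    q.  Half the l1 distance of the images is the excess mass
    \sum_t f t * (p t - q t), where f t is the P-mass of the set S of the rows
    in which the difference is nonnegative.  Since \sum_t (p t - q t) = 0, only
    the oscillation of f counts ([sum_mul_le_osc]), and delta bounds that
    oscillation by 1 - delta, because the upper bound of f on S is 1 minus the
    lower bound of the mass of the complement of S.  The product laws of m - 1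
    coordinates are at distance at most (m - 1) * |x - y|_1
    ([sum_norm_prod_sub_le]).

    On a vector of total mass 1, which the momentum correction always is, proj
    does not increase the l1 distance to a probability vector
    ([norm1_proj_le]), so a corrected step costs at most
    (1 + eta) * eta_m + eta by the triangle inequality; an uncorrected step
    costs eta_m, which is no larger. *)

(** * Finite sums and product laws *)

Section FiniteSums.
Variable R : realType.

Lemma sum_norm_zero_sum (I : finType) (v : I -> R) :
  \sum_i v i = 0 -> \sum_i `|v i| = 2 * \sum_i Num.max (v i) 0.
Proof.
move=> v0.
have -> : \sum_i `|v i| = \sum_i `|v i| + \sum_i v i by rewrite v0 addr0.
rewrite -big_split /= mulr_sumr.
apply: eq_bigr => i _; case: (leP 0 (v i)) => vi.
  by rewrite ger0_norm//; lra.
by rewrite ltr0_norm//; lra.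
Qed.

(** Because d has total mass 0, f may be recentred at the midpoint of [a, b],
    after which it is at most (b - a) / 2 in absolute value. *)
Lemma sum_mul_le_osc (I : finType) (f d : I -> R) (a b : R) :
  (forall i, a <= f i <= b) -> \sum_i d i = 0 ->
  \sum_i f i * d i <= (b - a) / 2 * \sum_i `|d i|.
Proof.
move=> fab d0.
have -> : \sum_i f i * d i = \sum_i (f i - (a + b) / 2) * d i.
  under [RHS]eq_bigr do rewrite mulrBl.
  by rewrite sumrB -mulr_sumr d0 mulr0 subr0.
rewrite mulr_sumr; apply: ler_sum => i _.
apply: le_trans (ler_norm _) _; rewrite normrM ler_wpM2r//.
by have /andP[? ?] := fab i; rewrite ler_norml; apply/andP; split; lra.
Qed.

(** The telescoping identity for a difference of products, with the triangle
    inequality: the j-th summand is the step between the hybrids that use u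
    before j and v after j.  Each summand is kept as a single product over all
    positions so that it can be summed over tuples coordinatewise. *)
Lemma norm_prod_sub_le k (u v : 'I_k -> R) :
  (forall s, 0 <= u s) -> (forall s, 0 <= v s) ->
  `|\prod_s u s - \prod_s v s| <=
  \sum_(j < k) \prod_(s < k) (if (s < j)%N then u s else
                              if s == j then `|u s - v s| else v s).
Proof.
elim: k u v => [|k IH] u v u0 v0; first by rewrite !big_ord0 subrr normr0.
rewrite !big_ord_recl /=.
set U := \prod_(i < k) _; set V := \prod_(i < k) v _.
have -> : u ord0 * U - v ord0 * V = (u ord0 - v ord0) * V + u ord0 * (U - V).
  by ring.
apply: le_trans (ler_normD _ _) _; apply: lerD.
  by rewrite normrM (ger0_norm (prodr_ge0 _ _)) // => i _.
rewrite normrM ger0_norm//.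
apply: le_trans (ler_wpM2l (u0 _) (IH _ _ _ _)) _ => //.
rewrite mulr_sumr; apply: ler_sum => j _.
rewrite big_ord_recl /= ler_wpM2l//.
Qed.

(** Product laws are compared coordinate by coordinate: each hybrid step
    factorises over the coordinates, all of which have mass 1 except the one
    that carries |x - y|. *)
Lemma sum_norm_prod_sub_le k (I : finType) (x y : I -> R) :
  (forall i, 0 <= x i) -> (forall i, 0 <= y i) ->
  \sum_i x i = 1 -> \sum_i y i = 1 ->
  \sum_(t : {ffun 'I_k -> I}) `|\prod_j x (t j) - \prod_j y (t j)| <=
  k%:R * \sum_i `|x i - y i|.
Proof.
move=> x0 y0 x1 y1.
pose g (j s : 'I_k) i :=
  if (s < j)%N then x i else if s == j then `|x i - y i| else y i.
apply: (@le_trans _ _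
    (\sum_(t : {ffun 'I_k -> I}) \sum_(j < k) \prod_s g j s (t s))).
  by apply: ler_sum => t _; apply: norm_prod_sub_le.
rewrite exchange_big /= (eq_bigr (fun=> \sum_i `|x i - y i|)) => [|j _].
  by rewrite sumr_const card_ord mulr_natl.
rewrite -bigA_distr_bigA (bigD1 j)//= [X in _ * X]big1 => [|s sj].
  by rewrite mulr1; apply: eq_bigr => i _; rewrite /g ltnn eqxx.
rewrite /g (negbTE sj).
by case: (ltnP s j) => _.
Qed.

Lemma sum_prod_eq1 k (I : finType) (x : I -> R) :
  \sum_i x i = 1 -> \sum_(t : {ffun 'I_k -> I}) \prod_j x (t j) = 1.
Proof. by move=> x1; rewrite -(bigA_distr_bigA (fun _ => x)) big1. Qed.

End FiniteSums.

(** * The l1 norm and the projection onto probability vectors *)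

Section Norm1.
Variables (R : realType) (n : nat).
Implicit Types x y : 'cV[R]_n.

Lemma norm1_ge0 x : 0 <= norm1 x.
Proof. by apply: sumr_ge0 => i _. Qed.

Lemma ler_norm1D x y : norm1 (x + y) <= norm1 x + norm1 y.
Proof.
by rewrite /norm1 -big_split; apply: ler_sum => i _; rewrite mxE ler_normD.
Qed.

Lemma norm1Z a x : norm1 (a *: x) = `|a| * norm1 x.
Proof. by rewrite mulr_sumr; apply: eq_bigr => i _; rewrite mxE normrM. Qed.

Lemma norm1_ge0E x : (forall i, 0 <= x i 0) -> norm1 x = \sum_i x i 0.
Proof. by move=> x0; apply: eq_bigr => i _; rewrite ger0_norm. Qed.

Lemma mx_norm_le_norm1 x : `|x| <= norm1 x.
Proof.
rewrite /Num.norm /= mx_normrE; apply: bigmax_le => [|[i j] _ /=].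
  exact: norm1_ge0.
rewrite ord1 /norm1 (bigD1 i)//= lerDl; exact: sumr_ge0.
Qed.

Lemma cvg_geometric_norm1 (u : nat -> 'cV[R]_n) x (e c : R) :
  0 <= e -> e < 1 -> (forall k, norm1 (u k - x) <= e ^+ k * c) ->
  u @ \oo --> x.
Proof.
move=> e0 e1 ux.
have geo : (fun k => e ^+ k * c) @ \oo --> 0.
  rewrite -[X in _ --> X](mul0r c); apply: cvgMl.
  by apply: cvg_expr; rewrite ger0_norm.
apply/cvgrPdist_le => d d0.
move/cvgrPdist_le: geo => /(_ _ d0); apply: filterS => k /=.
rewrite sub0r normrN => kd; rewrite distrC.
apply: le_trans (mx_norm_le_norm1 _) _; apply: le_trans (ux k) _.
exact: le_trans (ler_norm _) kd.
Qed.

Lemma norm1_pos_part_ge1 x : \sum_i x i 0 = 1 -> 1 <= norm1 (pos_part x).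
Proof.
move=> <-; apply: ler_sum => i _; rewrite mxE.
by rewrite (le_trans _ (ler_norm _))// le_max lexx.
Qed.

Lemma transition_vector_proj x :
  \sum_i x i 0 = 1 -> transition_vector (Defs.proj x).
Proof.
move=> x1; have A1 := norm1_pos_part_ge1 x1.
have p0 i : 0 <= pos_part x i 0 by rewrite mxE le_max lexx orbT.
split=> [i|]; first by rewrite mxE mulr_ge0// invr_ge0 norm1_ge0.
under eq_bigr do rewrite mxE.
by rewrite -mulr_sumr -norm1_ge0E// mulVf// gt_eqF// (lt_le_trans ltr01).
Qed.

(** Both distances are twice the mass of the positive part of the difference.
    The norm of x_+ is at least 1, so normalising only lowers the nonnegative
    entries of x, and the negative entries, once raised to 0, still do not
    exceed those of b. *)
Lemma norm1_proj_le x b : \sum_i x i 0 = 1 -> transition_vector b ->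
  norm1 (Defs.proj x - b) <= norm1 (x - b).
Proof.
move=> x1 [b0 b1]; have [_ p1] := transition_vector_proj x1.
have sum0 (z : 'cV[R]_n) : \sum_i z i 0 = 1 -> \sum_i (z - b) i 0 = 0.
  by move=> z1; under eq_bigr do rewrite !mxE; rewrite sumrB z1 b1 subrr.
rewrite /norm1 !sum_norm_zero_sum ?sum0// ler_wpM2l//.
apply: ler_sum => i _; rewrite ge_max !le_max lexx orbT andbT.
rewrite !mxE; set A := norm1 _.
have A1 : 1 <= A := norm1_pos_part_ge1 x1.
have A1' : A^-1 <= 1 by rewrite invf_le1// (lt_le_trans ltr01).
have A0 : 0 <= A^-1 by rewrite invr_ge0 norm1_ge0.
have [xi|xi] := leP 0 (x i 0).
  by apply/orP; left; rewrite lerD2r ler_piMl.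
by apply/orP; right; rewrite mulr0 sub0r oppr_le0.
Qed.

End Norm1.

(** * Contraction of the tensor map *)

Section TensorMap.
Variables (R : realType) (m n : nat) (P : tensor R m n).
Hypothesis hP : transition_tensor P.

Let mass (S : {set 'I_n}) (t : tail_index m n) := \sum_(i in S) P i t.

Lemma delta_le S : delta P <= fin_min (mass (~: S)) + fin_min (mass S).
Proof.
exact: (fin_minP (fun S => fin_min (mass (~: S)) + fin_min (mass S)) S).2.
Qed.

Lemma delta_le1 : (0 < n)%N -> delta P <= 1.
Proof.
move=> n0; have t0 : tail_index m n := [ffun=> Ordinal n0].
apply: le_trans (delta_le finset.set0) _; rewrite -[leRHS]addr0; apply: lerD.
  apply: le_trans ((fin_minP _ t0).2 t0) _.
  by rewrite /mass finset.setC0 -(hP.2 t0) (eq_bigl predT)// => i; rewrite inE.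
by apply: le_trans ((fin_minP _ t0).2 t0) _; rewrite /mass big_set0.
Qed.

Lemma transition_vector_tensor_apply x :
  transition_vector x -> transition_vector (tensor_apply P x).
Proof.
move=> [x0 x1]; split=> [i|].
  rewrite mxE; apply: sumr_ge0 => t _; apply: mulr_ge0; first exact: hP.1.
  exact: prodr_ge0.
under eq_bigr do rewrite mxE.
rewrite exchange_big /= -[RHS](sum_prod_eq1 m.-1 x1); apply: eq_bigr => t _.
by rewrite -mulr_suml hP.2 mul1r.
Qed.

(** With S the set of rows in which the two images differ by a nonnegative
    amount, half the distance is the change in the expectation of the S-mass
    [mass S], a function whose oscillation is at most 1 - delta P. *)
Lemma norm1_tensor_apply_le x y : (0 < n)%N ->
  transition_vector x -> transition_vector y ->
  norm1 (tensor_apply P x - tensor_apply P y) <=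
  (1 - delta P) * m.-1%:R * norm1 (x - y).
Proof.
move=> n0 tx ty; have t0 : tail_index m n := [ffun=> Ordinal n0].
pose d (t : tail_index m n) :=
  \prod_(j < m.-1) x (t j) 0 - \prod_(j < m.-1) y (t j) 0.
set v := tensor_apply P x - tensor_apply P y.
have vE i : v i 0 = \sum_t P i t * d t.
  by rewrite !mxE -sumrB; apply: eq_bigr => t _; rewrite mulrBr.
have d0 : \sum_t d t = 0.
  by rewrite sumrB (sum_prod_eq1 _ tx.2) (sum_prod_eq1 _ ty.2) subrr.
have v0 : \sum_i v i 0 = 0.
  have [_ x1] := transition_vector_tensor_apply tx.
  have [_ y1] := transition_vector_tensor_apply ty.
  rewrite (eq_bigr (fun i => tensor_apply P x i 0 - tensor_apply P y i 0)).
    by rewrite sumrB x1 y1 subrr.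
  by move=> i _; rewrite !mxE.
pose S : {set 'I_n} := [set i | 0 <= v i 0]%SET.
have -> : norm1 v = 2 * \sum_t mass S t * d t.
  rewrite /norm1 sum_norm_zero_sum//; congr (2 * _).
  rewrite (eq_bigr (fun i => if i \in S then v i 0 else 0)) => [|i _].
    rewrite -big_mkcond /=; under eq_bigr do rewrite vE.
    by rewrite exchange_big; apply: eq_bigr => t _; rewrite mulr_suml.
  by rewrite inE; case: leP.
have osc_mass t : fin_min (mass S) <= mass S t <= 1 - fin_min (mass (~: S)).
  apply/andP; split; first exact: (fin_minP _ t0).2.
  have -> : mass S t = 1 - mass (~: S) t.
    rewrite -(hP.2 t) (bigID (mem S)) /= /mass.
    rewrite [\sum_(i in ~: S) _](eq_bigl (fun i => i \notin S)) ?addrK//.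
    by move=> i; rewrite inE.
  by rewrite lerD2l lerN2; exact: (fin_minP _ t0).2.
have dS := delta_le S; have d1 := delta_le1 n0.
have := sum_mul_le_osc osc_mass d0.
have := sum_norm_prod_sub_le m.-1 tx.1 ty.1 tx.2 ty.2.
have -> : \sum_i `|x i 0 - y i 0| = norm1 (x - y).
  by apply: eq_bigr => i _; rewrite !mxE.
set D := \sum_t `|_| => D1 D2.
have D0 : 0 <= D by exact: sumr_ge0.
rewrite -mulrA; apply: le_trans (ler_wpM2l _ D1); last lra.
have : (1 - fin_min (mass (~: S)) - fin_min (mass S)) * D <= (1 - delta P) * D.
  by rewrite ler_wpM2r//; lra.
move: D2; lra.
Qed.

End TensorMap.

(** * Convergence of the momentum iteration *)

Theorem theorem2 (R : realType) (m n : nat) (hm : (2 <= m)%N) (hn : (1 <= n)%N)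
    (P : tensor R m n) (hP : transition_tensor P)
    (hdelta : (m%:R - 2) / (m%:R - 1) < delta P)
    (xbar : 'cV[R]_n)
    (hxbar : [/\ xbar = tensor_apply P xbar,
                 forall i, 0 <= xbar i 0 & norm1 xbar = 1])
    (eta : R) (heta0 : 0 < eta)
    (heta1 : eta < (1 - eta_coef P) / (1 + eta_coef P))
    (x0 : 'cV[R]_n) (hx0 : transition_vector x0) :
  (hopmm2 P eta x0 @ \oo --> xbar) /\
  (forall k : nat,
     norm1 (hopmm2 P eta x0 k - xbar) <=
     ((eta + 1) * eta_coef P + eta) ^+ k * norm1 (x0 - xbar)).
Proof.
have [xbar_fix xbar_ge0 xbar1] := hxbar.
have txbar : transition_vector xbar by split; rewrite // -norm1_ge0E.
set c := eta_coef P in heta1 *; set e := (eta + 1) * c + eta.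
have cE : c = (1 - delta P) * m.-1%:R.
  by rewrite /c /eta_coef -subn1 natrB // ltnW.
have c0 : 0 <= c by rewrite cE mulr_ge0// subr_ge0 delta_le1.
have ce : c <= e by rewrite /e; nra.
have e1 : e < 1.
  by move: heta1; rewrite ltr_pdivlMr; rewrite /e; nra.
(* The momentum term is a difference of vectors of equal mass, so the corrected
   vector keeps mass 1 even though it may have negative entries. *)
have momentum x : transition_vector x ->
    \sum_i (tensor_apply P x + eta *: (tensor_apply P x - x)) i 0 = 1.
  move=> tx; have [_ y1] := transition_vector_tensor_apply hP tx.
  set y := tensor_apply P x in y1 *.
  rewrite (eq_bigr (fun i => y i 0 + eta * (y i 0 - x i 0))) => [|i _].
    by rewrite big_split /= -mulr_sumr sumrB y1 tx.2 subrr mulr0 addr0.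
  by rewrite !mxE.
have iter_tv k : transition_vector (hopmm2 P eta x0 k).
  elim: k => [//|k IH] /=; case: ifP => _.
    exact: transition_vector_tensor_apply.
  by apply: transition_vector_proj; apply: momentum.
have bound k : norm1 (hopmm2 P eta x0 k - xbar) <= e ^+ k * norm1 (x0 - xbar).
  elim: k => [|k IH]; first by rewrite expr0 mul1r.
  rewrite exprS -mulrA.
  apply: le_trans (ler_wpM2l (le_trans c0 ce) IH).
  move: (iter_tv k) => /=; move: (hopmm2 P eta x0 k) => x tx.
  have yx : norm1 (tensor_apply P x - xbar) <= c * norm1 (x - xbar).
    by rewrite {1}xbar_fix cE norm1_tensor_apply_le.
  case: ifP => _; first exact: le_trans yx (ler_wpM2r (norm1_ge0 _) ce).
  apply: le_trans (norm1_proj_le (momentum _ tx) txbar) _.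
  set y := tensor_apply P x in yx *.
  have -> : y + eta *: (y - x) - xbar =
            (1 + eta) *: (y - xbar) + (- eta) *: (x - xbar).
    by apply/matrixP => i j; rewrite !mxE; ring.
  apply: le_trans (ler_norm1D _ _) _.
  rewrite !norm1Z normrN !ger0_norm ?addr_ge0 ?(ltW heta0)//.
  apply: le_trans (lerD (ler_wpM2l _ yx) (lexx _)) _; first by lra.
  by rewrite mulrA -mulrDl (addrC 1).
split=> //.
exact: cvg_geometric_norm1 (le_trans c0 ce) e1 bound.
Qed.
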